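(* Let $n\ge 2$. For every weighted balanced digraph $\Gamma'$ of order $n$ (with weights in $[0,1]$), the Laplacian spread satisfies $\operatorname{sp}(\Gamma')\le n-1$.
   Context: A (simple) weighted digraph of order $n$ is $\Gamma'=(V,E,w)$ with $V=\{1,\dots,n\}$ and weight function $w\colon V\times V\to[0,1]$, with the convention that $w(i,j)=0$ if and only if $(i,j)\notin E$; there are no loops, so $w(i,i)=0$. It is balanced if $\sum_{j\ne i}w(i,j)=\sum_{j\neq i}w(j,i)$ for all $i\in V$. Its adjacency matrix is $A=[w(i,j)]_{i,j=1}^n$ and its Laplacian matrix is $L=D-A$, where $D$ is the diagonal matrix whose $i$th diagonal entry is $\sum_{j}w(i,j)$. Let $\mathbf{e}$ be the all ones vector in $\mathbb{R}^n$. For $n\ge2$ define \[ \alpha(\Gamma')=\min_{\mathbf{x}\in\mathbb{R}^n,\ \mathbf{x}\perp\mathbf{e},\ \|\mathbf{x}\|=1}\mathbf{x}^TL\mathbf{x},\qquad \beta(\Gamma')=\max_{\mathbf{x}\in\mathbb{R}^n,\ \mathbf{x}\perp\mathbf{e},\ \|\mathbf{x}\|=1}\mathbf{x}^TL\mathbf{x}, \] where $\|\cdot\|$ is the Euclidean norm. The Laplacian spread is $\operatorname{sp}(\Gamma')=\beta(\Gamma')-\alpha(\Gamma')$. *)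

(* Defs.v *)
From HB Require Import structures.
From mathcomp Require Import all_boot all_order all_algebra.
From mathcomp Require Import all_classical all_reals all_analysis.
Set Implicit Arguments.
Unset Strict Implicit.
Unset Printing Implicit Defensive.
Import Order.TTheory GRing.Theory Num.Theory numFieldNormedType.Exports.
Local Open Scope classical_set_scope.
Local Open Scope ring_scope.

Record wdigraph (R : realType) (n : nat) := WDigraph {
  edge : rel 'I_n;
  weight : 'I_n -> 'I_n -> R;
  weight_itv : forall i j, 0 <= weight i j <= 1;
  weight_eq0 : forall i j, weight i j = 0 <-> ~~ edge i j;
  edge_irr : irreflexive edge
}.

Definition balanced (R : realType) (n : nat) (G : wdigraph R n) : Prop :=
  forall i, \sum_(j | j != i) weight G i j = \sum_(j | j != i) weight G j i.

Definition adjacency (R : realType) (n : nat) (G : wdigraph R n) : 'M[R]_n :=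
  \matrix_(i, j) weight G i j.

Definition outdegrees (R : realType) (n : nat) (G : wdigraph R n) : 'rV[R]_n :=
  \row_i \sum_j weight G i j.

Definition laplacian (R : realType) (n : nat) (G : wdigraph R n) : 'M[R]_n :=
  diag_mx (outdegrees G) - adjacency G.

Definition dotv (R : realType) (n : nat) (x y : 'cV[R]_n) : R :=
  (x^T *m y) 0 0.

(* The norm `|x| of the library on matrices is the sup norm. *)
Definition norm2 (R : realType) (n : nat) (x : 'cV[R]_n) : R :=
  Num.sqrt (dotv x x).

Definition all_ones (R : realType) (n : nat) : 'cV[R]_n := const_mx 1.
Arguments all_ones R n : clear implicits.

Definition unit_perp (R : realType) (n : nat) : set 'cV[R]_n :=
  [set x | dotv x (all_ones R n) = 0 /\ norm2 x = 1].
Arguments unit_perp R n : clear implicits.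

Definition qform (R : realType) (n : nat) (L : 'M[R]_n) (x : 'cV[R]_n) : R :=
  (x^T *m L *m x) 0 0.

(* inf and sup are total; for 1 < n they are a minimum and a maximum, see
   alphaP and betaP below. *)
Definition alpha (R : realType) (n : nat) (G : wdigraph R n) : R :=
  inf (qform (laplacian G) @` unit_perp R n).

Definition beta (R : realType) (n : nat) (G : wdigraph R n) : R :=
  sup (qform (laplacian G) @` unit_perp R n).

Definition laplacian_spread (R : realType) (n : nat) (G : wdigraph R n) : R :=
  beta G - alpha G.

Section Attained.
Variables (R : realType) (n : nat).
Implicit Types (L : 'M[R]_n) (v : 'rV[R]_n) (x y : 'cV[R]_n).

Lemma dotvE x y : dotv x y = \sum_i x i 0 * y i 0.
Proof. by rewrite /dotv mxE; apply: eq_bigr => i _; rewrite mxE. Qed.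

Lemma qformE L x : qform L x = \sum_j (\sum_i x i 0 * L i j) * x j 0.
Proof.
rewrite /qform mxE; apply: eq_bigr => j _; rewrite mxE; congr (_ * _).
by apply: eq_bigr => i _; rewrite mxE.
Qed.

Lemma continuous_qform L : continuous (fun v : 'rV[R]_n => qform L v^T).
Proof.
under eq_fun do rewrite qformE.
apply: continuous_big => [|j _]; first exact: add_continuous.
under eq_fun do rewrite mxE.
move=> v; apply: continuousM; last exact: coord_continuous.
move: v; apply: continuous_big => [|i _]; first exact: add_continuous.
under eq_fun do rewrite mxE.
by move=> v; apply: continuousM; [exact: coord_continuous|exact: cst_continuous].
Qed.

Lemma dotv_qform x : dotv x x = qform 1%:M x.
Proof. by rewrite /dotv /qform mulmx1. Qed.

Lemma continuous_dotv y : continuous (fun v : 'rV[R]_n => dotv v^T y).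
Proof.
under eq_fun do rewrite dotvE.
apply: continuous_big => [|i _]; first exact: add_continuous.
under eq_fun do rewrite mxE.
by move=> v; apply: continuousM; [exact: coord_continuous|exact: cst_continuous].
Qed.

Lemma norm2_eq1 x : (norm2 x = 1) <-> (dotv x x = 1).
Proof.
rewrite /norm2; split => [h|->]; last exact: sqrtr1.
rewrite -[LHS]sqr_sqrtr ?h ?expr1n// dotvE sumr_ge0// => i _.
by rewrite -expr2 sqr_ge0.
Qed.

Lemma unit_perp_compact : compact [set v : 'rV[R]_n | unit_perp R n v^T].
Proof.
apply: bounded_closed_compact.
  exists 1; split; first exact: num_real.
  move=> M M1 v [_ /norm2_eq1 v1] /=.
  rewrite (le_trans _ (ltW M1))// [leLHS]/Num.Def.normr /= mx_normrE.
  apply/bigmax_leP; split => //= -[i j] _ /=; rewrite ord1.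
  rewrite -(@ler_pXn2r _ 2%N) ?nnegrE// expr1n real_normK ?num_real// -v1 dotvE.
  rewrite (bigD1 j)//= mxE -expr2 lerDl sumr_ge0// => k _.
  by rewrite mxE -expr2 sqr_ge0.
rewrite (_ : [set v | _] =
    (fun v : 'rV[R]_n => dotv v^T (all_ones R n)) @^-1` [set r | r = 0] `&`
    (fun v : 'rV[R]_n => qform 1%:M v^T) @^-1` [set r | r = 1]).
  apply: closedI; apply: preimage_closed; try exact: closed_eq.
  - by move=> v _; exact: continuous_dotv.
  - by move=> v _; exact: continuous_qform.
apply/seteqP; split => v [h1 h2]; split => //=.
  by rewrite -dotv_qform; apply/norm2_eq1.
by apply/norm2_eq1; rewrite dotv_qform.
Qed.

Lemma unit_perp_nonempty : (2 <= n)%N ->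
  [set v : 'rV[R]_n | unit_perp R n v^T] !=set0.
Proof.
move=> n2; pose i0 := Ordinal (ltnW n2 : (0 < n)%N); pose i1 := Ordinal n2.
pose c : R := (Num.sqrt 2)^-1.
have sum2 (f : 'I_n -> R) : (forall i, i != i0 -> i != i1 -> f i = 0) ->
    \sum_i f i = f i0 + f i1.
  move=> f0; rewrite (bigD1 i0)//= (bigD1 i1)//= big1 ?addr0//.
  by move=> i /andP[*]; exact: f0.
exists (\row_i (if i == i0 then c else if i == i1 then - c else 0)).
split => /=.
  rewrite dotvE sum2 => [|i /negPf i_0 /negPf i_1].
    by rewrite !mxE/= !mulr1 subrr.
  by rewrite !mxE i_0 i_1 mul0r.
apply/norm2_eq1; rewrite dotvE sum2 => [|i /negPf i_0 /negPf i_1].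
  rewrite !mxE/= mulrNN -expr2 /c exprVn sqr_sqrtr//.
  by rewrite -mulr2n -[LHS]mulr_natl divff.
by rewrite !mxE i_0 i_1 mul0r.
Qed.

Lemma alphaP (G : wdigraph R n) : (2 <= n)%N ->
  (exists2 x, unit_perp R n x & alpha G = qform (laplacian G) x) /\
  (forall x, unit_perp R n x -> alpha G <= qform (laplacian G) x).
Proof.
move=> n2; set f := fun v : 'rV[R]_n => qform (laplacian G) v^T.
have [|v /set_mem/= vU vmin] := @EVT_min_rV _ _ f _ (unit_perp_nonempty n2)
    unit_perp_compact.
  exact/continuous_subspaceT/continuous_qform.
have lbv x : unit_perp R n x -> qform (laplacian G) v^T <= qform (laplacian G) x.
  by move=> xU; rewrite -[x]trmxK; apply: vmin; rewrite inE/= trmxK.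
suff -> : alpha G = qform (laplacian G) v^T by split=> //; exists v^T.
have vI : (qform (laplacian G) @` unit_perp R n) (qform (laplacian G) v^T).
  by exists v^T.
have vlb : lbound (qform (laplacian G) @` unit_perp R n)
    (qform (laplacian G) v^T) by move=> _ [x xU <-]; exact: lbv.
apply/eqP; rewrite eq_le; apply/andP; split.
  by apply: ge_inf vI; exists (qform (laplacian G) v^T).
by apply: lb_le_inf vlb; exists (qform (laplacian G) v^T).
Qed.

Lemma betaP (G : wdigraph R n) : (2 <= n)%N ->
  (exists2 x, unit_perp R n x & beta G = qform (laplacian G) x) /\
  (forall x, unit_perp R n x -> qform (laplacian G) x <= beta G).
Proof.
move=> n2; set f := fun v : 'rV[R]_n => qform (laplacian G) v^T.
have [|v /set_mem/= vU vmax] := @EVT_max_rV _ _ f _ (unit_perp_nonempty n2)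
    unit_perp_compact.
  exact/continuous_subspaceT/continuous_qform.
have ubv x : unit_perp R n x -> qform (laplacian G) x <= qform (laplacian G) v^T.
  by move=> xU; rewrite -[x]trmxK; apply: vmax; rewrite inE/= trmxK.
suff -> : beta G = qform (laplacian G) v^T by split=> //; exists v^T.
have vI : (qform (laplacian G) @` unit_perp R n) (qform (laplacian G) v^T).
  by exists v^T.
have vub : ubound (qform (laplacian G) @` unit_perp R n)
    (qform (laplacian G) v^T) by move=> _ [x xU <-]; exact: ubv.
apply/eqP; rewrite eq_le; apply/andP; split.
  by apply: ge_sup vub; exists (qform (laplacian G) v^T).
by apply: ub_le_sup vI; exists (qform (laplacian G) v^T).
Qed.

End Attained.

(* Main.v *)
Require Import Defs.
From mathcomp Require Import all_boot all_order all_algebra.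
From mathcomp Require Import all_classical all_reals all_analysis.
From mathcomp Require Import ring lra.
Import Order.TTheory GRing.Theory Num.Theory.
Local Open Scope ring_scope.

(* Let x and y be the unit vectors attaining beta and alpha.  As the weights lie
   in [0,1], beta - alpha is at most the sum over i < j of
   (x_i - x_j)^2 - min((x_i - x_j)^2, (y_i - y_j)^2), that is n - T with T the
   sum of the minima, so it suffices that T >= 1.  Regard i |-> (x_i, y_i) as n
   points of the plane and call the segment ij steep when
   (y_i - y_j)^2 <= (x_i - x_j)^2.  Two sides of each triangle have the same
   type, so the sum of det^2 over pairs of segments of the same type is at least
   the sum over triangles, which is n (1 - rho^2) with rho = <x, y>.  By
   Lagrange's identity applied to each type separately, it is also at most
   n T - n^2 rho^2 / 2, and n >= 2 gives T >= 1.  All sums below range over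
   ordered pairs and triples, whence the extra numerical factors. *)

(** Used with [P] always true for the segments leaving one vertex, and with [P] selecting one type
    among all segments. Ordered pairs account for the factor 2. *)
Lemma lagrange_identity (R : comNzRingType) (I : finType) (P : pred I)
    (f g : I -> R) :
  \sum_(a | P a) \sum_(b | P b) (f a * g b - f b * g a) ^+ 2 =
  2 * ((\sum_(a | P a) f a ^+ 2) * (\sum_(a | P a) g a ^+ 2)
       - (\sum_(a | P a) f a * g a) ^+ 2).
Proof.
set F := \sum_(a | P a) f a ^+ 2; set G := \sum_(a | P a) g a ^+ 2.
set H := \sum_(a | P a) f a * g a.
transitivity (\sum_(a | P a)
    (f a ^+ 2 * G + g a ^+ 2 * F - 2 * H * (f a * g a))).
  apply: eq_bigr => a _.
  rewrite /G /F /H !(mulr_sumr, mulr_suml) -big_split/= -sumrB.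
  by apply: eq_bigr => b _; ring.
rewrite sumrB big_split/= -!mulr_suml -mulr_sumr -/F -/G -/H; ring.
Qed.

(** * Segments between [n] points of the plane with centroid 0 *)

Section PairSums.
Variables (R : realFieldType) (n : nat).
Implicit Types x y : 'I_n -> R.

Definition diff x (a : 'I_n * 'I_n) := x a.1 - x a.2.

Definition det x y (a b : 'I_n * 'I_n) :=
  diff x a * diff y b - diff x b * diff y a.

Definition steep x y (a : 'I_n * 'I_n) := diff y a ^+ 2 <= diff x a ^+ 2.

Definition det_same x y (a b : 'I_n * 'I_n) :=
  (steep x y a == steep x y b)%:R * det x y a b ^+ 2.

Lemma steepC x y i j : steep x y (j, i) = steep x y (i, j).
Proof. by rewrite /steep /diff/= -sqrrN opprB -[leRHS]sqrrN opprB. Qed.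

Lemma sum_diffM_at x y i : \sum_j x j = 0 -> \sum_j y j = 0 ->
  \sum_j diff x (i, j) * diff y (i, j) =
  \sum_j x j * y j + n%:R * (x i * y i).
Proof.
move=> x0 y0; rewrite /diff/=.
transitivity (\sum_j (x i * y i - x i * y j - y i * x j + x j * y j)).
  by apply: eq_bigr => j _; ring.
rewrite big_split/= !sumrB -!mulr_sumr x0 y0 sumr_const card_ord -mulr_natl.
ring.
Qed.

Lemma sum_diff_sqr_at x i : \sum_j x j = 0 ->
  \sum_j diff x (i, j) ^+ 2 = \sum_j x j ^+ 2 + n%:R * x i ^+ 2.
Proof. by move=> x0; under eq_bigr do rewrite expr2; rewrite sum_diffM_at. Qed.

Lemma sum_diffM x y : \sum_j x j = 0 -> \sum_j y j = 0 ->
  \sum_a diff x a * diff y a = 2 * n%:R * \sum_j x j * y j.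
Proof.
move=> x0 y0.
rewrite -(pair_bigA _ (fun i j => diff x (i, j) * diff y (i, j)))/=.
under eq_bigr do rewrite sum_diffM_at//.
rewrite big_split/= -mulr_sumr sumr_const card_ord -mulr_natl; ring.
Qed.

Lemma sum_diff_sqr x : \sum_j x j = 0 ->
  \sum_a diff x a ^+ 2 = 2 * n%:R * \sum_j x j ^+ 2.
Proof. by move=> x0; under eq_bigr do rewrite expr2; rewrite sum_diffM. Qed.

(** Lagrange's identity at each vertex [i]: the quartic terms of [(1 + n x_i^2) (1 + n y_i^2) - (rho
    + n x_i y_i)^2] cancel, and the rest sums by the normalisation. *)
Lemma sum_det_sqr x y : \sum_j x j = 0 -> \sum_j y j = 0 ->
  \sum_j x j ^+ 2 = 1 -> \sum_j y j ^+ 2 = 1 ->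
  \sum_i \sum_j \sum_k det x y (i, j) (i, k) ^+ 2 =
  6 * n%:R * (1 - (\sum_j x j * y j) ^+ 2).
Proof.
move=> x0 y0 x1 y1; set rho := \sum_j x j * y j.
transitivity (\sum_i 2 * (1 - rho ^+ 2 + n%:R * x i ^+ 2 + n%:R * y i ^+ 2
    - 2 * n%:R * rho * (x i * y i))).
  apply: eq_bigr => i _.
  rewrite (lagrange_identity _ _ xpredT (fun j => diff x (i, j))
    (fun j => diff y (i, j))).
  by rewrite !sum_diff_sqr_at// sum_diffM_at// x1 y1 -/rho; ring.
rewrite -mulr_sumr sumrB !big_split/= -!mulr_sumr x1 y1 -/rho !sumr_const.
rewrite card_ord -mulr_natl; ring.
Qed.

(** * Triangles against pairs of segments of the same type *)

Lemma det_same_triangle x y i j k :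
  det x y (i, j) (i, k) ^+ 2 <=
  det_same x y (i, j) (i, k) + det_same x y (j, i) (j, k)
  + det_same x y (k, i) (k, j).
Proof.
rewrite /det_same (steepC x y i j) (steepC x y i k) (steepC x y j k).
(* Seen from any vertex, the determinant is up to sign twice the area of the triangle. Two of the
   three sides share a type, so at least one indicator is 1. *)
have -> : det x y (j, i) (j, k) = - det x y (i, j) (i, k).
  by rewrite /det /diff/=; ring.
have -> : det x y (k, i) (k, j) = det x y (i, j) (i, k).
  by rewrite /det /diff/=; ring.
have := sqr_ge0 (det x y (i, j) (i, k)).
rewrite sqrrN; case: steep; case: steep; case: steep => /=; lra.
Qed.

Lemma sum_det_same_triangle x y :
  \sum_i \sum_j \sum_k det x y (i, j) (i, k) ^+ 2 <=
  3 * \sum_i \sum_j \sum_k det_same x y (i, j) (i, k).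
Proof.
set S := \sum_i \sum_j \sum_k det_same _ _ _ _.
have -> : 3 * S = S + \sum_i \sum_j \sum_k det_same x y (j, i) (j, k)
    + \sum_i \sum_j \sum_k det_same x y (k, i) (k, j).
  rewrite [X in S + X]exchange_big/= -/S.
  have -> : \sum_i \sum_j \sum_k det_same x y (k, i) (k, j) = S.
    under eq_bigr do rewrite exchange_big/=.
    by rewrite exchange_big.
  ring.
rewrite /S -!big_split/=; apply: ler_sum => i _.
rewrite -!big_split/=; apply: ler_sum => j _.
rewrite -!big_split/=; apply: ler_sum => k _.
exact: det_same_triangle.
Qed.

(* Two edges sharing a vertex arise from four choices of orientations; the
   choices only overlap where the determinant vanishes. *)
Lemma det_same_adjacent x y i j k l :
  det_same x y (i, j) (k, l) *
    ((k == i)%:R + (k == j)%:R + (l == i)%:R + (l == j)%:R) <=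
  det_same x y (i, j) (k, l).
Proof.
have F0 : 0 <= det_same x y (i, j) (k, l) by rewrite mulr_ge0 ?ler0n ?sqr_ge0.
have [d0|/eqP d0] := eqVneq (det x y (i, j) (k, l)) 0.
  by rewrite /det_same d0 expr0n/= mulr0 mul0r.
rewrite -[leRHS]mulr1 ler_wpM2l//.
have ij : i != j by apply/eqP => e; apply: d0; rewrite e /det /diff/=; ring.
have kl : k != l by apply/eqP => e; apply: d0; rewrite e /det /diff/=; ring.
have ijkl : ~~ ((k == i) && (l == j)).
  apply/negP => /andP[/eqP ek /eqP el]; apply: d0.
  by rewrite ek el /det /diff/=; ring.
have ijlk : ~~ ((k == j) && (l == i)).
  apply/negP => /andP[/eqP ek /eqP el]; apply: d0.
  by rewrite ek el /det /diff/=; ring.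
move: ij kl ijkl ijlk.
have [->|_] := eqVneq k i.
  by rewrite (eq_sym l i); case: (i == j); case: (i == l);
    case: (l == j) => //= *; lra.
have [->|_] := eqVneq k j.
  by rewrite (eq_sym l j); case: (i == j); case: (j == l);
    case: (l == i) => //= *; lra.
have [->|_] := eqVneq l i; first by case: (i == j) => //= *; lra.
case: (l == j) => /= *; lra.
Qed.

Lemma sum_det_same_ge x y :
  4 * (\sum_i \sum_j \sum_k det_same x y (i, j) (i, k)) <=
  \sum_a \sum_b det_same x y a b.
Proof.
set S := \sum_i _.
have FlC a k l : det_same x y a (l, k) = det_same x y a (k, l).
  by rewrite /det_same steepC /det /diff/=; congr (_ * _); ring.
have FrC i j b : det_same x y (j, i) b = det_same x y (i, j) b.
  by rewrite /det_same steepC /det /diff/=; congr (_ * _); ring.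
have sum_eq (f : 'I_n -> R) i : \sum_k f k * (k == i)%:R = f i.
  rewrite (bigD1 i)//= eqxx mulr1 big1 ?addr0// => k /negPf->.
  by rewrite mulr0.
rewrite -(pair_bigA _ (fun i j => \sum_b det_same x y (i, j) b))/=.
(* The common vertex may be either end of the first segment, hence two kinds of terms. Each
   coefficient 2 counts the orientations of the second segment. *)
have -> : 4 * S = \sum_i \sum_j \sum_k
    (2 * det_same x y (i, j) (i, k) + 2 * det_same x y (j, i) (j, k)).
  transitivity (2 * S + 2 * S); first ring.
  have {2}-> : S = \sum_i \sum_j \sum_k det_same x y (j, i) (j, k).
    by rewrite exchange_big.
  rewrite !mulr_sumr -big_split/=.
  apply: eq_bigr => i _; rewrite !mulr_sumr -big_split/=.
  by apply: eq_bigr => j _; rewrite !mulr_sumr -big_split.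
apply: ler_sum => i _; apply: ler_sum => j _.
rewrite -(pair_bigA _ (fun k l => det_same x y (i, j) (k, l)))/=.
apply: le_trans (ler_sum _ (fun k _ => ler_sum _ (fun l _ =>
  det_same_adjacent x y i j k l))).
have -> : \sum_k \sum_l det_same x y (i, j) (k, l) *
    ((k == i)%:R + (k == j)%:R + (l == i)%:R + (l == j)%:R) =
  \sum_l det_same x y (i, j) (i, l) + \sum_l det_same x y (i, j) (j, l)
  + \sum_k det_same x y (i, j) (k, i) + \sum_k det_same x y (i, j) (k, j).
  under eq_bigr do under eq_bigr do rewrite !mulrDr.
  under eq_bigr do rewrite !big_split/=.
  rewrite !big_split/=; congr (_ + _ + _ + _).
  - by rewrite exchange_big; apply: eq_bigr => l _; rewrite sum_eq.
  - by rewrite exchange_big; apply: eq_bigr => l _; rewrite sum_eq.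
  - by apply: eq_bigr => k _; rewrite sum_eq.
  - by apply: eq_bigr => k _; rewrite sum_eq.
rewrite -!big_split/= le_eqVlt; apply/orP; left; apply/eqP.
apply: eq_bigr => k _; rewrite !(FlC _ _ k) (FrC i j); ring.
Qed.

(** * Lower bound for the sum of the minima *)

Lemma sum_det_same x y :
  \sum_a \sum_b det_same x y a b =
  \sum_(a | steep x y a) \sum_(b | steep x y b) det x y a b ^+ 2 +
  \sum_(a | ~~ steep x y a) \sum_(b | ~~ steep x y b) det x y a b ^+ 2.
Proof.
rewrite (bigID (steep x y))/=; congr (_ + _); apply: eq_bigr => a sa;
  rewrite [RHS]big_mkcond; apply: eq_bigr => b _; rewrite /det_same.
  by rewrite sa; case: steep; rewrite /= ?mul1r ?mul0r.
by rewrite (negPf sa); case: steep; rewrite /= ?mul1r ?mul0r.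
Qed.

Lemma sum_min_diff_ge x y : (2 <= n)%N ->
  \sum_j x j = 0 -> \sum_j y j = 0 ->
  \sum_j x j ^+ 2 = 1 -> \sum_j y j ^+ 2 = 1 ->
  2 <= \sum_a Num.min (diff x a ^+ 2) (diff y a ^+ 2).
Proof.
move=> n2 x0 y0 x1 y1.
have -> : \sum_a Num.min (diff x a ^+ 2) (diff y a ^+ 2) =
    \sum_(a | steep x y a) diff y a ^+ 2
    + \sum_(a | ~~ steep x y a) diff x a ^+ 2.
  rewrite (bigID (steep x y))/=; congr (_ + _); apply: eq_bigr => a.
    by move=> /min_idPr.
  by rewrite /steep -ltNge => /ltW /min_idPl.
have triangles := sum_det_same_triangle x y.
have edges := sum_det_same_ge x y.
move: triangles edges; rewrite sum_det_sqr// sum_det_same /det.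
rewrite !lagrange_identity.
have := sum_diffM _ _ x0 y0; rewrite (bigID (steep x y))/=.
have := sum_diff_sqr _ x0; rewrite x1 mulr1 (bigID (steep x y))/=.
have := sum_diff_sqr _ y0; rewrite y1 mulr1 (bigID (steep x y))/=.
set rho := \sum_j _; set S := \sum_i _.
set Xs := \sum_(a | steep x y a) diff x a ^+ 2.
set Xf := \sum_(a | ~~ steep x y a) diff x a ^+ 2.
set Ys := \sum_(a | steep x y a) diff y a ^+ 2.
set Yf := \sum_(a | ~~ steep x y a) diff y a ^+ 2.
set cs := \sum_(a | _) _; set cf := \sum_(a | _) _.
move=> Yn Xn cn triangles edges.
have {n2} : (2 : R) <= n%:R by rewrite ler_nat.
move: (n%:R : R) => N in Yn Xn cn triangles *; move=> N2.
have Xf0 : 0 <= Xf by apply: sumr_ge0 => *; exact: sqr_ge0.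
have Ys0 : 0 <= Ys by apply: sumr_ge0 => *; exact: sqr_ge0.
have XsE : Xs = 2 * N - Xf by lra.
have YfE : Yf = 2 * N - Ys by lra.
(* As [cs + cf = 2 * N * rho], the squares sum to at least half of [(2 * N * rho) ^+ 2]. *)
have c2 : 2 * N ^+ 2 * rho ^+ 2 <= cs ^+ 2 + cf ^+ 2.
  have := sqr_ge0 (cs - cf).
  have -> : 2 * N ^+ 2 * rho ^+ 2 = (2 * N * rho) ^+ 2 / 2 by field.
  rewrite -cn; nra.
(* With [T = Ys + Xf], the bounds combine to [2 N T >= 4 N + 2 N (N - 2) rho^2 + 2 Ys Xf]. The last
   two terms are nonnegative, the first of them because [N >= 2]. *)
have XY : 0 <= Ys * Xf by rewrite mulr_ge0.
have rhoN : 0 <= rho ^+ 2 * N * (N - 2).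
  by rewrite -mulrA mulr_ge0 ?sqr_ge0// mulr_ge0 ?subr_ge0//; lra.
rewrite -(@ler_pM2l _ N); last by apply: lt_le_trans N2; lra.
rewrite XsE YfE in edges; lra.
Qed.

End PairSums.
Arguments diff {R n} x a.
Arguments sum_diff_sqr {R n x}.
Arguments sum_min_diff_ge {R n x y}.

(** * The Laplacian form and the spread *)

Lemma qform_laplacian (R : realType) (n : nat) (G : wdigraph R n)
    (x : 'cV[R]_n) : balanced G ->
  2 * qform (laplacian G) x =
  \sum_a weight G a.1 a.2 * diff (fun i => x i 0) a ^+ 2.
Proof.
move=> bG.
have inout i : \sum_j weight G i j = \sum_j weight G j i.
  by rewrite (bigD1 i)//= bG [RHS](bigD1 i).
rewrite -(pair_bigA _ (fun i j =>
  weight G i j * diff (fun i => x i 0) (i, j) ^+ 2))/=.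
transitivity (\sum_i \sum_j weight G i j * x i 0 ^+ 2
  + \sum_i \sum_j weight G i j * x j 0 ^+ 2
  - 2 * \sum_i \sum_j weight G i j * (x i 0 * x j 0)); last first.
  rewrite mulr_sumr -big_split/= -sumrB; apply: eq_bigr => i _.
  rewrite mulr_sumr -big_split/= -sumrB; apply: eq_bigr => j _.
  rewrite /diff/=; ring.
(* Balance enters here: equal in- and outdegrees let the squares at the heads of the edges be
   replaced by those at the tails. *)
have -> : \sum_i \sum_j weight G i j * x j 0 ^+ 2 =
    \sum_i \sum_j weight G i j * x i 0 ^+ 2.
  rewrite exchange_big/=; apply: eq_bigr => i _.
  by rewrite -!mulr_suml inout.
have -> : qform (laplacian G) x =
    \sum_i \sum_j weight G i j * x i 0 ^+ 2
    - \sum_i \sum_j weight G i j * (x i 0 * x j 0).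
  rewrite qformE [X in _ - X]exchange_big/= -sumrB; apply: eq_bigr => j _.
  rewrite mulr_suml.
  have LE i : laplacian G i j =
    (\sum_k weight G i k) *+ (i == j) - weight G i j by rewrite !mxE.
  under [LHS]eq_bigr => i _ do rewrite LE mulrBr mulrBl.
  rewrite sumrB; congr (_ - _); last by apply: eq_bigr => i _; ring.
  rewrite (bigD1 j)//= eqxx mulr1n -[RHS]mulr_suml [X in _ + X]big1.
    by ring.
  by move=> i /negPf->; rewrite mulr0n mulr0 mul0r.
ring.
Qed.

Lemma unit_perpP (R : realType) (n : nat) (x : 'cV[R]_n) : unit_perp R n x ->
  \sum_i x i 0 = 0 /\ \sum_i x i 0 ^+ 2 = 1.
Proof.
move=> [x0 /norm2_eq1 x1]; split.
  by rewrite -[RHS]x0 dotvE; apply: eq_bigr => i _; rewrite mxE mulr1.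
by rewrite -[RHS]x1 dotvE; apply: eq_bigr => i _; rewrite expr2.
Qed.

Theorem corollary5p3 (R : realType) (n : nat) (hn : (2 <= n)%N)
  (G : wdigraph R n) (hG : balanced G) :
  laplacian_spread G <= n%:R - 1.
Proof.
have [[x /unit_perpP[x0 x1] betaE] _] := betaP G hn.
have [[y /unit_perpP[y0 y1] alphaE] _] := alphaP G hn.
rewrite /laplacian_spread betaE alphaE.
have minge := sum_min_diff_ge hn x0 y0 x1 y1.
have := sum_diff_sqr x0; rewrite x1 mulr1 => diffx.
(* Over ordered pairs the first sum is [2 n] and the sum of minima is at least 2; halving leaves
   [n - 1]. *)
suff : 2 * qform (laplacian G) x - 2 * qform (laplacian G) y <=
    \sum_a diff (fun i => x i 0) a ^+ 2
    - \sum_a Num.min (diff (fun i => x i 0) a ^+ 2)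
                     (diff (fun i => y i 0) a ^+ 2) by lra.
rewrite !qform_laplacian// -!sumrB; apply: ler_sum => a _.
have /andP[w0 w1] := weight_itv G a.1 a.2.
rewrite -mulrBr; set dx := diff _ _ ^+ 2; set dy := diff _ _ ^+ 2.
have [dxy|dyx] := leP dx dy.
  by rewrite subrr mulr_ge0_le0// subr_le0.
by rewrite ler_piMl// subr_ge0 ltW.
Qed.
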